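(* Let $H$ be a Hilbert space of holomorphic functions on the unit disk $\mathbb D$ such that norm convergence in $H$ implies pointwise convergence on $\mathbb D$ and $H$ contains the polynomials. Let $K(z,w)$ be its reproducing kernel and, for $j\ge0$, $k_{0,j}(z):=\frac1{j!}\frac{\partial^j}{\partial\overline w^j}K(z,w)\big|_{w=0}$. For $\alpha\ge0$ and $h\in H$ with Taylor coefficients $\hat h(j)$, let $\sigma_n^\alpha(h):=\sum_{j=0}^n\binom{n}{j}\big/\binom{n+\alpha}{j}\,\hat h(j)z^j$. If $\sigma_n^\alpha(h)\to h$ (weakly or in norm) in $H$ for all $h\in H$, then \[ \|z^j\|_H\,\|k_{0,j}\|_H=O(j^\alpha)\quad(j\to\infty). \]
   Context: The reproducing kernel is $K(z,w)=k_w(z)$ where $k_w\in H$ satisfies $h(w)=\langle h,k_w\rangle$ for all $h\in H$. Binomial coefficients with non-integer arguments are defined via the Gamma function. *)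

(* Defs.v *)
From Stdlib Require Import Reals Arith.
From Coquelicot Require Import Coquelicot.

Local Open Scope R_scope.

Definition Disk (z : C) : Prop := Cmod z < 1.

Definition C_differentiable (f : C -> C) (z : C) : Prop :=
  @ex_derive C_AbsRing C_NormedModule f z.

(** A complex Hilbert space H of holomorphic functions on the unit disk.
    Elements are abstract vectors [v : hs_car]; [hs_ev v : C -> C] is the
    function represented by v (only its values on the disk matter).
    Vector operations are pointwise on the disk, and a vector is determined
    by its values on the disk. *)
Record HilbFunSpace := {
  hs_car :> Type;
  hs_add : hs_car -> hs_car -> hs_car;
  hs_scal : C -> hs_car -> hs_car;
  hs_zero : hs_car;
  hs_ip : hs_car -> hs_car -> C;
  hs_ev : hs_car -> C -> C;
  hs_ev_inj : forall u v : hs_car,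
      (forall z, Disk z -> hs_ev u z = hs_ev v z) -> u = v;
  hs_ev_add : forall u v z, Disk z ->
      hs_ev (hs_add u v) z = (hs_ev u z + hs_ev v z)%C;
  hs_ev_scal : forall a v z, Disk z ->
      hs_ev (hs_scal a v) z = (a * hs_ev v z)%C;
  hs_ev_zero : forall z, Disk z -> hs_ev hs_zero z = 0%C;
  hs_holo : forall v z, Disk z -> C_differentiable (hs_ev v) z;
  hs_ip_addl : forall u v w, hs_ip (hs_add u v) w = (hs_ip u w + hs_ip v w)%C;
  hs_ip_scall : forall a u w, hs_ip (hs_scal a u) w = (a * hs_ip u w)%C;
  hs_ip_herm : forall u v, hs_ip u v = Cconj (hs_ip v u);
  hs_ip_pos : forall u, 0 <= Re (hs_ip u u);
  hs_ip_def : forall u, hs_ip u u = 0%C -> u = hs_zero;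
  hs_complete : forall s : nat -> hs_car,
      (forall eps, 0 < eps -> exists N, forall m n, (N <= m)%nat -> (N <= n)%nat ->
         let d := hs_add (s m) (hs_scal (RtoC (-1)) (s n)) in
         sqrt (Re (hs_ip d d)) < eps) ->
      exists h, is_lim_seq (fun n =>
         let d := hs_add (s n) (hs_scal (RtoC (-1)) h) in
         sqrt (Re (hs_ip d d))) 0
}.

Arguments hs_add {h}. Arguments hs_scal {h}. Arguments hs_zero {h}.
Arguments hs_ip {h}. Arguments hs_ev {h}.

Section Ops.
Variable H : HilbFunSpace.

Definition hsub (u v : H) : H := hs_add u (hs_scal (RtoC (-1)) v).
Definition hnorm (v : H) : R := sqrt (Re (hs_ip v v)).

Definition norm_conv (s : nat -> H) (h : H) : Prop :=
  is_lim_seq (fun n => hnorm (hsub (s n) h)) 0.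
Definition weak_conv (s : nat -> H) (h : H) : Prop :=
  forall g : H, is_lim_seq (fun n => Cmod (hs_ip (s n) g - hs_ip h g)%C) 0.
End Ops.

Definition polyfun (a : nat -> C) (n : nat) (z : C) : C :=
  sum_n (fun j => (a j * Cpow z j)%C) n.

Definition C_derive_n (j : nat) (f : C -> C) : C -> C := Nat.iter j C_derive f.

Definition taylor_coef (f : C -> C) (j : nat) : C :=
  (C_derive_n j f 0 / RtoC (INR (fact j)))%C.

(** Wirtinger derivative  d/d(conj w) g = conj( d/dw conj(g) ),
    and its iterates. *)
Definition dbar (g : C -> C) (w : C) : C :=
  Cconj (C_derive (fun u => Cconj (g u)) w).
Definition dbar_n (j : nat) (g : C -> C) : C -> C := Nat.iter j dbar g.

(** Generalized binomial coefficient  binom(x, j) = x (x-1) ... (x-j+1) / j!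
    (agrees with the Gamma-function definition whenever x - j + 1 > 0,
    in particular for x = n + alpha, alpha >= 0, j <= n). *)
Fixpoint falling (x : R) (j : nat) : R :=
  match j with
  | O => 1
  | S i => falling x i * (x - INR i)
  end.
Definition gbinom (x : R) (j : nat) : R := falling x j / INR (fact j).

Definition sigma_fun (alpha : R) (n : nat) (f : C -> C) (z : C) : C :=
  polyfun (fun j => (RtoC (gbinom (INR n) j / gbinom (INR n + alpha) j)
                     * taylor_coef f j)%C) n z.

Definition k0j {H : HilbFunSpace} (k : C -> H) (j : nat) (z : C) : C :=
  (/ RtoC (INR (fact j)) * dbar_n j (fun w => hs_ev (k w) z) 0)%C.

(* Main.v *)
(** Let a_j(h) be the Taylor coefficients of h and A_n the coefficients of
    (1 - t)^(-1-alpha), so that sigma_n = A_n^(-1) sum_(j <= n) A_(n-j) a_j z^j.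
    The coefficients of (1 - t)^(1+alpha) are absolutely summable, and convolving
    with them recovers a_n z^n from the means; hence the terms of a series with
    bounded means of order alpha are O(A_n) = O(n^alpha).  Applied to <sigma_n(h), g>
    for all g, the uniform boundedness principle gives |a_j(h)| ||z^j|| <= C(h) A_j;
    applied once more, over h, it gives ||z^j|| ||v_j|| = O(A_j), where v_j represents
    the functional a_j.

    No Cauchy theory is needed to find v_j.  The same bound, with sigma_n(h)(x) -> h(x),
    shows that h is near 0 on the real axis the sum of its Taylor series, so a_n(h) is a
    limit of difference quotients of evaluations of h; a weak limit of vectors of H
    exists by uniform boundedness and the Riesz theorem.  Finally
    k_(0,j)(z) = conj(a_j(k_z)) = v_j(z). *)

Require Import Defs.
From Stdlib Require Import Reals Arith Lra Lia Classical IndefiniteDescription.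
From Coquelicot Require Import Coquelicot.

Local Open Scope R_scope.

(** * Cesàro means *)

Definition conv (u v : nat -> R) (n : nat) : R :=
  sum_f_R0 (fun j => u j * v (n - j)%nat) n.

Lemma sum_f_R0_0 (f : nat -> R) n :
  (forall i, (i <= n)%nat -> f i = 0) -> sum_f_R0 f n = 0.
Proof.
intros h; induction n as [|n IH]; simpl; [now apply h; lia|].
rewrite IH, h; [ring|lia|intros; apply h; lia].
Qed.

Lemma conv_S (u v : nat -> R) n :
  conv u v (S n) = u 0%nat * v (S n) + conv (fun i => u (S i)) v n.
Proof. unfold conv; now rewrite decomp_sum; [|lia]. Qed.

Lemma conv_ext (u u' v v' : nat -> R) n :
  (forall i, u i = u' i) -> (forall i, v i = v' i) -> conv u v n = conv u' v' n.
Proof. intros h h'; apply sum_eq; intros i _; now rewrite h, h'. Qed.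

Lemma conv_linl (c : R) (u u' v : nat -> R) n :
  conv (fun i => c * u i + u' i) v n = c * conv u v n + conv u' v n.
Proof.
unfold conv; rewrite scal_sum, <- sum_plus; apply sum_eq; intros; ring.
Qed.

Lemma conv_assoc (u v w : nat -> R) n :
  conv (conv u v) w n = conv u (conv v w) n.
Proof.
revert u; induction n as [|n IH]; intros u; [unfold conv; simpl; ring|].
rewrite !conv_S.
rewrite (conv_ext (fun i => conv u v (S i)) (fun i => u 0%nat * v (S i) + conv (fun i => u (S i)) v i) _ w)
  by (intros; trivial; apply conv_S).
rewrite conv_linl, IH.
change (conv u v 0) with (u 0%nat * v 0%nat); ring.
Qed.

(* The Taylor coefficients of (1 - t)^(-x). *)
Fixpoint negbin (x : R) (n : nat) : R :=
  match n with
  | O => 1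
  | S m => negbin x m * (x + INR m) / INR (S m)
  end.

Lemma negbin_S x n : INR (S n) * negbin x (S n) = (x + INR n) * negbin x n.
Proof.
assert (INR (S n) <> 0) by (apply not_0_INR; lia).
cbn [negbin]; field; trivial.
Qed.

(* Differentiating (1 - t)^(-x) (1 - t)^(-y) and comparing coefficients. *)
Lemma conv_negbin_S x y n :
  INR (S n) * conv (negbin x) (negbin y) (S n)
  = (x + y + INR n) * conv (negbin x) (negbin y) n.
Proof.
unfold conv.
transitivity
  (sum_f_R0 (fun i => INR i * negbin x i * negbin y (S n - i)) (S n)
   + sum_f_R0 (fun i => INR (S n - i) * negbin x i * negbin y (S n - i)) (S n)).
  rewrite scal_sum, <- sum_plus; apply sum_eq; intros i hi.
  rewrite minus_INR by lia; ring.
rewrite (decomp_sum _ (S n)) by lia; simpl pred.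
rewrite (tech5 _ n), Nat.sub_diag.
rewrite !Rmult_0_l, Rplus_0_l, Rplus_0_r, <- sum_plus, scal_sum.
apply sum_eq; intros i hi.
replace (S n - S i)%nat with (n - i)%nat by lia.
replace (S n - i)%nat with (S (n - i)) by lia.
rewrite negbin_S.
replace (INR (S (n - i)) * negbin x i * negbin y (S (n - i)))
  with (negbin x i * (INR (S (n - i)) * negbin y (S (n - i)))) by ring.
rewrite negbin_S, (minus_INR n i) by lia; ring.
Qed.

(** The product of (1 - t)^(-x) and (1 - t)^x is 1. For y = -x the recurrence kills the coefficient
    of index 1, and each later one is a multiple of its predecessor. *)
Lemma conv_negbin_opp x n : conv (negbin x) (negbin (- x)) (S n) = 0.
Proof.
induction n as [|n IH].
  pose proof (conv_negbin_S x (- x) 0) as h; simpl in h.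
  rewrite !Rmult_1_l in h; rewrite h; ring.
pose proof (conv_negbin_S x (- x) (S n)) as h; rewrite IH, Rmult_0_r in h.
apply Rmult_integral in h; destruct h as [h|h]; [|exact h].
exfalso; revert h; apply not_0_INR; lia.
Qed.

Lemma conv_negbin_inv x (b : nat -> R) n :
  conv (conv b (negbin x)) (negbin (- x)) n = b n.
Proof.
rewrite conv_assoc; unfold conv at 1; destruct n as [|n].
  unfold conv; simpl; ring.
rewrite tech5, Nat.sub_diag, sum_f_R0_0; [unfold conv; simpl; ring|].
intros i hi; replace (S n - i)%nat with (S (n - i)) by lia.
rewrite conv_negbin_opp; ring.
Qed.

Lemma negbin_pos x n : 0 < x -> 0 < negbin x n.
Proof.
intros hx; induction n as [|n IH]; cbn [negbin]; [lra|].
pose proof (pos_INR n); apply Rdiv_lt_0_compat; [|apply lt_0_INR; lia].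
apply Rmult_lt_0_compat; lra.
Qed.

Lemma negbin_incr x m n : 1 <= x -> (m <= n)%nat -> negbin x m <= negbin x n.
Proof.
intros hx; induction 1 as [|n _ IH]; [lra|].
apply Rle_trans with (1 := IH).
pose proof (negbin_pos x n ltac:(lra)); pose proof (pos_INR n).
cbn [negbin]; apply Rle_div_r; [apply Rlt_gt, lt_0_INR; lia|].
rewrite S_INR; apply Rmult_le_compat_l; lra.
Qed.

(* For n >= x the terms have constant sign, and
   n |B_n| - (n + 1) |B_(n+1)| = x |B_n| telescopes. *)
Lemma negbin_opp_abs_summable x :
  0 < x -> exists K, forall n, sum_f_R0 (fun i => Rabs (negbin (- x) i)) n <= K.
Proof.
intros hx; set (B := fun i => Rabs (negbin (- x) i)).
destruct (nfloor_ex x ltac:(lra)) as [N hN].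
assert (step : forall n, (S N <= n)%nat ->
  INR n * B n - INR (S n) * B (S n) = x * B n).
  intros n hn; apply le_INR in hn; rewrite S_INR in hn.
  unfold B; rewrite <- (Rabs_pos_eq (INR (S n))) at 1 by apply pos_INR.
  rewrite <- Rabs_mult, negbin_S, Rabs_mult, (Rabs_pos_eq (- x + INR n)) by lra.
  ring.
(* By [step], the left-hand side has the same value for every n beyond [N]. *)
assert (bound : forall n, (S N <= n)%nat ->
  sum_f_R0 B n + INR (S n) * B (S n) / x
  <= sum_f_R0 B (S N) + INR (S (S N)) * B (S (S N)) / x).
  induction 1 as [|n hn IH]; [lra|].
  apply Rle_trans with (2 := IH); rewrite tech5.
  pose proof (step (S n) ltac:(lia)) as hs.
  replace (B (S n)) with ((INR (S n) * B (S n) - INR (S (S n)) * B (S (S n))) / x) at 1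
    by (rewrite hs; field; lra).
  right; field; lra.
exists (sum_f_R0 B (S N) + INR (S (S N)) * B (S (S N)) / x); intros n.
assert (Bge : forall i, 0 <= B i) by (intros; apply Rabs_pos).
apply Rle_trans with (sum_f_R0 B (n + S N)).
  generalize (S N); intros m; induction m as [|m IH]; [rewrite Nat.add_0_r; lra|].
  rewrite Nat.add_succ_r, tech5; pose proof (Bge (S (n + m))); lra.
apply Rle_trans with (2 := bound (n + S N)%nat ltac:(lia)).
pose proof (Bge (S (n + S N))); pose proof (pos_INR (S (n + S N))).
enough (0 <= INR (S (n + S N)) * B (S (n + S N)) / x) by lra.
apply Rle_div_r; [lra|]; rewrite Rmult_0_l; now apply Rmult_le_pos.
Qed.

Lemma falling_neq_0 alpha n j : 0 <= alpha -> (j <= n)%nat ->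
  falling (INR n + alpha) j <> 0.
Proof.
intros ha; induction j as [|j IH]; intros hj; simpl; [lra|].
apply Rmult_integral_contrapositive_currified; [apply IH; lia|].
apply lt_INR in hj; lra.
Qed.

(** The weights of the means are A_(n-j) / A_n. Raising j by one brings the factor (n - j) / (n +
    alpha - j), which undoes one step of the recurrence for [negbin]. *)
Lemma gbinom_ratio alpha n j : 0 <= alpha -> (j <= n)%nat ->
  gbinom (INR n) j / gbinom (INR n + alpha) j * negbin (1 + alpha) n
  = negbin (1 + alpha) (n - j).
Proof.
intros ha; assert (hf : forall i, INR (fact i) <> 0) by (intros; apply INR_fact_neq_0).
pose proof (fun i => falling_neq_0 alpha n i ha) as nz.
induction j as [|j IH]; intros hj.
  rewrite Nat.sub_0_r; unfold gbinom; simpl; field.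
assert (e : gbinom (INR n) (S j) / gbinom (INR n + alpha) (S j)
  = gbinom (INR n) j / gbinom (INR n + alpha) j
    * ((INR n - INR j) / (INR n + alpha - INR j))).
  unfold gbinom; simpl falling.
  pose proof (nz j ltac:(lia)); pose proof (nz (S j) hj) as h; simpl in h.
  field; repeat split; auto; intros h'; apply h; rewrite h'; ring.
rewrite e, Rmult_assoc, (Rmult_comm (_ / _) (negbin _ _)), <- Rmult_assoc, IH by lia.
replace (n - j)%nat with (S (n - S j)) by lia; cbn [negbin].
rewrite <- minus_INR by lia; replace (n - j)%nat with (S (n - S j)) by lia.
assert (INR n = INR j + INR (n - S j) + 1).
  rewrite minus_INR, S_INR by lia; ring.
replace (INR n + alpha - INR j) with (1 + alpha + INR (n - S j)) by lra.
rewrite S_INR; pose proof (pos_INR (n - S j)); field; lra.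
Qed.

Lemma gbinom_ratio_bounds alpha n j : 0 <= alpha -> (j <= n)%nat ->
  0 <= gbinom (INR n) j / gbinom (INR n + alpha) j <= 1.
Proof.
intros ha hj; pose proof (gbinom_ratio alpha n j ha hj) as e.
pose proof (negbin_pos (1 + alpha) n ltac:(lra)).
pose proof (negbin_pos (1 + alpha) (n - j) ltac:(lra)).
pose proof (negbin_incr (1 + alpha) (n - j) n ltac:(lra) ltac:(lia)).
split; apply (Rmult_le_reg_r (negbin (1 + alpha) n)); lra.
Qed.

(** Raising j by one brings the factor 1 - alpha / (n + alpha - j), which tends to 1. *)
Lemma gbinom_ratio_lim alpha j : 0 <= alpha ->
  is_lim_seq (fun n => gbinom (INR n) j / gbinom (INR n + alpha) j) 1.
Proof.
intros ha; induction j as [|j IH].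
  apply is_lim_seq_ext with (2 := is_lim_seq_const 1).
  intros n; unfold gbinom; simpl; field.
apply is_lim_seq_ext_loc with (fun n => gbinom (INR n) j / gbinom (INR n + alpha) j
    * (1 - alpha * / (INR n + alpha - INR j))).
  exists (S j); intros n hn; apply lt_INR in hn.
  pose proof (falling_neq_0 alpha n j ha ltac:(apply INR_lt in hn; lia)) as nz.
  unfold gbinom; simpl falling; field.
  pose proof (INR_fact_neq_0 j); pose proof (INR_fact_neq_0 (S j)).
  repeat split; auto; lra.
replace (Finite 1) with (Finite (1 * (1 - alpha * 0))) by (f_equal; ring).
apply is_lim_seq_mult'; [exact IH|].
apply is_lim_seq_minus'; [apply is_lim_seq_const|].
apply is_lim_seq_mult'; [apply is_lim_seq_const|].
assert (h : is_lim_seq (fun n => INR n + alpha - INR j) p_infty).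
  apply is_lim_seq_ext with (fun n => INR n + (alpha - INR j)); [intros; ring|].
  eapply is_lim_seq_plus; [apply is_lim_seq_INR|apply is_lim_seq_const|reflexivity].
apply (is_lim_seq_inv _ _ h); discriminate.
Qed.

(* Summability (C, alpha) forces the terms to be O(n^alpha): convolving with the
   coefficients of (1 - t)^(1 + alpha), which are absolutely summable, recovers
   the terms from the means. *)
Lemma cesaro_term_bound alpha : 0 <= alpha -> exists K, 0 <= K /\
  forall (b : nat -> R) (M : R),
  (forall n, Rabs (sum_f_R0 (fun j =>
     gbinom (INR n) j / gbinom (INR n + alpha) j * b j) n) <= M) ->
  forall n, Rabs (b n) <= K * M * negbin (1 + alpha) n.
Proof.
intros ha; destruct (negbin_opp_abs_summable (1 + alpha) ltac:(lra)) as [K hK].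
exists K; split.
  apply Rle_trans with (2 := hK 0%nat); simpl; apply Rabs_pos.
intros b M hM n; set (A := negbin (1 + alpha)).
(* Multiplied by A_m, the mean of order m becomes the convolution of [b] with A. *)
assert (hD : forall m, Rabs (conv b A m) <= M * A m).
  intros m; pose proof (negbin_pos (1 + alpha) m ltac:(lra)).
  replace (conv b A m) with (A m * sum_f_R0 (fun j =>
     gbinom (INR m) j / gbinom (INR m + alpha) j * b j) m).
    rewrite Rabs_mult, (Rabs_pos_eq (A m)) by (unfold A; lra).
    rewrite Rmult_comm; apply Rmult_le_compat_r; [unfold A; lra|apply hM].
  unfold conv; rewrite scal_sum; apply sum_eq; intros j hj.
  unfold A; rewrite <- gbinom_ratio by trivial; ring.
assert (hM0 : 0 <= M) by (apply Rle_trans with (2 := hM 0%nat), Rabs_pos).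
rewrite <- (conv_negbin_inv (1 + alpha) b n).
apply Rle_trans with (1 := Rsum_abs _ _).
apply Rle_trans with (sum_f_R0 (fun i => Rabs (negbin (- (1 + alpha)) (n - i)) * (M * A n)) n).
  apply sum_Rle; intros i hi; rewrite Rabs_mult, Rmult_comm.
  apply Rmult_le_compat_l; [apply Rabs_pos|].
  apply Rle_trans with (1 := hD i), Rmult_le_compat_l; [exact hM0|].
  apply negbin_incr; [lra|exact hi].
rewrite <- scal_sum; replace (K * M * A n) with (M * A n * K) by ring.
apply Rmult_le_compat_l.
  apply Rmult_le_pos; [exact hM0|apply Rlt_le, negbin_pos; lra].
apply Rle_trans with (2 := hK n); right.
exact (sum_f_R0_skip (fun i => Rabs (negbin (- (1 + alpha)) i)) n).
Qed.

(** Each ratio (x + n) / (n + 1) is at most x. This crude bound serves to give the Taylor series a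
    positive radius of convergence. *)
Lemma negbin_le_pow x n : 1 <= x -> negbin x n <= x ^ n.
Proof.
intros hx; induction n as [|n IH]; [simpl; lra|].
pose proof (negbin_pos x n ltac:(lra)); pose proof (pos_INR n).
cbn [negbin]; apply Rle_div_l; [apply Rlt_gt, lt_0_INR; lia|].
rewrite S_INR; simpl.
replace (x * x ^ n * (INR n + 1)) with (x ^ n * (x * (INR n + 1))) by ring.
apply Rmult_le_compat; nra.
Qed.

(** With m = n + 2, the ratio of successive terms is 1 + alpha / m <= exp (alpha / m) <= (m / (m -
    1))^alpha, the last because ln r >= 1 - 1 / r. The powers telescope. *)
Lemma negbin_le_Rpower alpha n : 0 <= alpha ->
  negbin (1 + alpha) (S n) <= (1 + alpha) * Rpower (INR (S n)) alpha.
Proof.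
intros ha; induction n as [|n IH].
  simpl; unfold Rpower; rewrite ln_1, Rmult_0_r, exp_0; lra.
assert (h1 : 0 < INR (S n)) by (apply lt_0_INR; lia).
assert (h2 : INR (S (S n)) = INR (S n) + 1) by apply S_INR.
assert (hr : 1 + alpha / INR (S (S n)) <= Rpower (INR (S (S n)) / INR (S n)) alpha).
  apply Rle_trans with (1 := exp_ineq1_le _); unfold Rpower.
  assert (exp_le : forall u v, u <= v -> exp u <= exp v).
    intros u v [h| ->]; [left; now apply exp_increasing|lra].
  apply exp_le, Rmult_le_compat_l; [exact ha|].
  rewrite <- (Ropp_involutive (ln _)), <- ln_Rinv by (apply Rdiv_lt_0_compat; lra).
  pose proof (exp_ineq1_le (ln (/ (INR (S (S n)) / INR (S n))))) as h.
  rewrite exp_ln in h by (apply Rinv_0_lt_compat, Rdiv_lt_0_compat; lra).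
  replace (/ (INR (S (S n)) / INR (S n))) with (1 - / INR (S (S n))) in h at 2
    by (rewrite h2; field; lra).
  lra.
replace (negbin (1 + alpha) (S (S n)))
  with (negbin (1 + alpha) (S n) * (1 + alpha / INR (S (S n))))
  by (cbn [negbin]; rewrite h2; field; lra).
replace (INR (S (S n))) with (INR (S n) * (INR (S (S n)) / INR (S n))) at 2
  by (field; lra).
rewrite <- Rpower_mult_distr by (try apply Rdiv_lt_0_compat; lra).
rewrite <- Rmult_assoc; apply Rmult_le_compat; [|..|exact hr]; [| |exact IH].
  apply Rlt_le, negbin_pos; lra.
assert (0 <= alpha / INR (S (S n))) by (apply Rle_div_r; lra); lra.
Qed.

(** * Uniform boundedness and Riesz representation *)

Section RealHilbert.
Variable H : HilbFunSpace.
Implicit Types u v w x y : H.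

(** The real part makes [H] a real Hilbert space with the same norm. Uniform boundedness and Riesz
    are proved there; imaginary parts come back through multiplication by [Ci]. *)
Definition rip u v : R := Re (hs_ip u v).
Definition rscal (r : R) u : H := hs_scal (RtoC r) u.

Lemma rip_sym u v : rip u v = rip v u.
Proof. unfold rip; now rewrite hs_ip_herm, re_conj. Qed.

Lemma rip_addl u v w : rip (hs_add u v) w = rip u w + rip v w.
Proof. unfold rip; now rewrite hs_ip_addl. Qed.

Lemma rip_scall r u w : rip (rscal r u) w = r * rip u w.
Proof. unfold rip, rscal; rewrite hs_ip_scall; unfold Re; simpl; ring. Qed.

Lemma rip_addr u v w : rip w (hs_add u v) = rip w u + rip w v.
Proof. now rewrite !(rip_sym w), rip_addl. Qed.

Lemma rip_scalr r u w : rip w (rscal r u) = r * rip w u.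
Proof. now rewrite !(rip_sym w), rip_scall. Qed.

Lemma rip_subl u v w : rip (hsub H u v) w = rip u w - rip v w.
Proof.
unfold hsub; change (hs_scal (RtoC (-1)) v) with (rscal (-1) v).
rewrite rip_addl, rip_scall; ring.
Qed.

Lemma rip_subr u v w : rip w (hsub H u v) = rip w u - rip w v.
Proof. now rewrite !(rip_sym w), rip_subl. Qed.

Lemma rip_ge0 u : 0 <= rip u u.
Proof. apply hs_ip_pos. Qed.

Lemma hnorm_ge0 u : 0 <= hnorm H u.
Proof. apply sqrt_pos. Qed.

Lemma hnorm_sqr u : hnorm H u * hnorm H u = rip u u.
Proof. apply sqrt_sqrt, rip_ge0. Qed.

Lemma rip_le_hnorm u v : Rabs (rip u v) <= hnorm H u * hnorm H v.
Proof.
assert (cs : rip u v * rip u v <= rip u u * rip v v).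
  pose proof (rip_ge0 u); pose proof (rip_ge0 v).
  pose proof (rip_ge0 (hsub H (rscal (rip v v) u) (rscal (rip u v) v))) as h.
  rewrite !rip_subl, !rip_subr, !rip_scall, !rip_scalr, (rip_sym v u) in h.
  destruct (Req_dec (rip v v) 0) as [e|ne]; [|apply Rmult_le_reg_l with (rip v v); lra].
  destruct (Req_dec (rip u v) 0) as [e'|ne]; [rewrite e, e'; lra|].
  (* Here |v| = 0, and the multiple of v is chosen so that the square expands to - |u|^2 - 2, which
     is absurd. *)
  pose proof (rip_ge0 (hsub H u (rscal ((rip u u + 1) / rip u v) v))) as h'.
  rewrite !rip_subl, !rip_subr, !rip_scall, !rip_scalr, (rip_sym v u), e in h'.
  replace ((rip u u + 1) / rip u v * rip u v) with (rip u u + 1) in h' by (field; trivial).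
  lra.
pose proof (hnorm_ge0 u); pose proof (hnorm_ge0 v).
apply Rsqr_incr_0_var; [|now apply Rmult_le_pos].
rewrite <- Rsqr_abs; unfold Rsqr.
apply Rle_trans with (1 := cs); rewrite <- !hnorm_sqr; right; ring.
Qed.

Lemma hnorm_le u c : 0 <= c -> rip u u <= c * c -> hnorm H u <= c.
Proof.
intros hc h; rewrite <- (sqrt_square c hc); now apply sqrt_le_1_alt.
Qed.

Lemma hnorm_rscal r u : hnorm H (rscal r u) = Rabs r * hnorm H u.
Proof.
unfold hnorm; fold (rip (rscal r u) (rscal r u)); fold (rip u u).
rewrite rip_scall, rip_scalr, <- Rmult_assoc, sqrt_mult_alt by apply Rle_0_sqr.
f_equal; apply sqrt_Rsqr_abs.
Qed.

Lemma hsub_triangle u v w :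
  hnorm H (hsub H u w) <= hnorm H (hsub H u v) + hnorm H (hsub H v w).
Proof.
pose proof (hnorm_ge0 (hsub H u v)) as h1; pose proof (hnorm_ge0 (hsub H v w)) as h2.
apply hnorm_le; [lra|].
pose proof (rip_le_hnorm (hsub H u v) (hsub H v w)) as cs.
apply Rabs_le_between in cs.
apply Rle_trans with (rip (hsub H u v) (hsub H u v) + rip (hsub H v w) (hsub H v w)
  + 2 * rip (hsub H u v) (hsub H v w)).
  rewrite !rip_subl, !rip_subr, (rip_sym v u), (rip_sym w u), (rip_sym w v); lra.
rewrite <- !hnorm_sqr; nra.
Qed.

(** The factor 3 / 2 is the sum of the geometric series of ratio 1 / 3. The explicit rate serves
    both the gliding hump and the minimising sequence of [riesz]. *)
Lemma geometric_cauchy_limit (x : nat -> H) :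
  (forall m, hnorm H (hsub H (x (S m)) (x m)) <= (1 / 3) ^ m) ->
  exists y, forall m, hnorm H (hsub H y (x m)) <= 3 / 2 * (1 / 3) ^ m.
Proof.
intros hx.
assert (pow3 : forall m, 0 < (1 / 3) ^ m) by (intros; apply pow_lt; lra).
assert (fwd : forall m p, hnorm H (hsub H (x (m + p)%nat) (x m))
  <= 3 / 2 * ((1 / 3) ^ m - (1 / 3) ^ (m + p))).
  intros m p; induction p as [|p IH].
    rewrite Nat.add_0_r; apply hnorm_le; [lra|].
    rewrite !rip_subl, !rip_subr; lra.
  rewrite Nat.add_succ_r; pose proof (hx (m + p)%nat) as h.
  pose proof (hsub_triangle (x (S (m + p))) (x (m + p)%nat) (x m)).
  simpl ((1 / 3) ^ (S (m + p))); lra.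
assert (swap : forall u v, hnorm H (hsub H u v) = hnorm H (hsub H v u)).
  intros u v; unfold hnorm; f_equal.
  change (rip (hsub H u v) (hsub H u v) = rip (hsub H v u) (hsub H v u)).
  rewrite !rip_subl, !rip_subr, (rip_sym u v); ring.
destruct (hs_complete H x) as [y hy].
  intros eps heps.
  destruct (pow_lt_1_zero (1 / 3) ltac:(rewrite Rabs_pos_eq; lra) (eps / 4) ltac:(lra))
    as [N hN].
  exists N; intros m n hm hn; simpl.
  change (hnorm H (hsub H (x m) (x n)) < eps).
  pose proof (hN N (le_n N)) as h; rewrite Rabs_pos_eq in h by (apply Rlt_le, pow3).
  pose proof (fwd N (m - N)%nat) as h1; pose proof (fwd N (n - N)%nat) as h2.
  replace (N + (m - N))%nat with m in h1 by lia.
  replace (N + (n - N))%nat with n in h2 by lia.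
  pose proof (hsub_triangle (x m) (x N) (x n)) as h3; rewrite (swap (x N)) in h3.
  pose proof (pow3 m); pose proof (pow3 n); lra.
exists y; intros m; apply le_epsilon; intros eps heps.
apply is_lim_seq_spec in hy; destruct (hy (mkposreal eps heps)) as [N hN]; simpl in hN.
specialize (hN (m + N)%nat ltac:(lia)).
change (Rabs (hnorm H (hsub H (x (m + N)%nat) y) - 0) < eps) in hN.
rewrite Rminus_0_r, Rabs_pos_eq in hN by apply hnorm_ge0.
pose proof (fwd m N); pose proof (hsub_triangle y (x (m + N)%nat) (x m)) as h.
rewrite (swap y (x (m + N)%nat)) in h; pose proof (pow3 (m + N)%nat); lra.
Qed.

(* Gliding hump: if f_k in W has norm > (k + 1) 3^k, then adding
   +- 3^-k f_k / |f_k| successively yields a vector on which W is unbounded. *)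
Lemma uniform_boundedness (W : H -> Prop) :
  (forall x, exists M, forall w, W w -> Rabs (rip x w) <= M) ->
  exists M, 0 <= M /\ forall w, W w -> hnorm H w <= M.
Proof.
intros hW; apply NNPP; intros unb.
assert (large : forall k, exists w, W w /\ (INR k + 1) * 3 ^ k < hnorm H w).
  intros k; apply NNPP; intros hk; apply unb; exists ((INR k + 1) * 3 ^ k).
  split; [apply Rmult_le_pos; [pose proof (pos_INR k); lra|apply pow_le; lra]|].
  intros w hw; apply Rnot_lt_le; intros h; apply hk; now exists w.
apply functional_choice in large; destruct large as [f hf].
(* The sign is that of [rip x (f k)], so the new term cannot cancel what is already there. *)
set (step k x := hs_add x (rscal
  ((if Rle_dec 0 (rip x (f k)) then 1 else -1) * ((1 / 3) ^ k / hnorm H (f k))) (f k))).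
set (x := fix x k := match k with O => hs_zero | S m => step m (x m) end).
assert (pow3 : forall m, 0 < (1 / 3) ^ m) by (intros; apply pow_lt; lra).
assert (fpos : forall k, 0 < hnorm H (f k)).
  intros k; apply Rle_lt_trans with (2 := proj2 (hf k)).
  apply Rmult_le_pos; [pose proof (pos_INR k); lra|apply pow_le; lra].
destruct (geometric_cauchy_limit x) as [y hy].
  intros m; apply hnorm_le; [apply Rlt_le, pow3|].
  change (x (S m)) with (step m (x m)); unfold step.
  rewrite !rip_subl, !rip_subr, !rip_addl, !rip_addr, !rip_scall, !rip_scalr.
  rewrite (rip_sym (f m) (x m)), <- (hnorm_sqr (f m)).
  right; specialize (fpos m); destruct Rle_dec; field; lra.
destruct (hW y) as [M hM]; destruct (nfloor_ex (Rmax M 0)) as [k hk]; [apply Rmax_r|].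
(* With m = 2 k + 1, the final lower bound (m + 1) / 2 equals k + 1, which exceeds [M]. *)
set (m := S (2 * k)).
specialize (hM (f m) (proj1 (hf m))); specialize (hy (S m)); specialize (fpos m).
assert (h1 : (1 / 3) ^ m * hnorm H (f m) <= Rabs (rip (x (S m)) (f m))).
  change (x (S m)) with (step m (x m)); unfold step.
  rewrite rip_addl, rip_scall, <- hnorm_sqr.
  replace (_ * (_ / _) * _) with ((if Rle_dec 0 (rip (x m) (f m)) then 1 else -1) *
    ((1 / 3) ^ m * hnorm H (f m))) by (field; lra).
  pose proof (Rmult_lt_0_compat _ _ (pow3 m) fpos).
  destruct Rle_dec; [rewrite Rabs_pos_eq|rewrite Rabs_left]; lra.
(* All the later increments together undo at most half of the m-th one. *)
assert (h2 : Rabs (rip y (f m) - rip (x (S m)) (f m))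
    <= 1 / 2 * ((1 / 3) ^ m * hnorm H (f m))).
  rewrite <- rip_subl; apply Rle_trans with (1 := rip_le_hnorm _ _).
  apply Rle_trans with (3 / 2 * (1 / 3) ^ S m * hnorm H (f m)).
    apply Rmult_le_compat_r; lra.
  simpl; right; field.
assert (h3 : INR m + 1 < (1 / 3) ^ m * hnorm H (f m)).
  replace (INR m + 1) with ((1 / 3) ^ m * ((INR m + 1) * 3 ^ m)).
    apply Rmult_lt_compat_l; [apply pow3|apply hf].
  rewrite (Rmult_comm _ (3 ^ m)), <- Rmult_assoc, <- Rpow_mult_distr.
  replace (1 / 3 * 3) with 1 by field; rewrite pow1; ring.
pose proof (Rabs_triang_inv (rip (x (S m)) (f m)) (rip (x (S m)) (f m) - rip y (f m))) as h4.
rewrite (Rabs_minus_sym (rip (x (S m)) (f m)) (rip y (f m))) in h4.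
replace (rip (x (S m)) (f m) - (rip (x (S m)) (f m) - rip y (f m)))
  with (rip y (f m)) in h4 by ring.
assert (hm : INR m = 2 * INR k + 1) by (unfold m; rewrite S_INR, mult_INR; simpl; ring).
pose proof (Rmax_l M 0).
lra.
Qed.

(* The representing vector minimises |x|^2 - 2 l(x). *)
Lemma riesz (l : H -> R) (M : R) :
  (forall x y, l (hs_add x y) = l x + l y) ->
  (forall r x, l (rscal r x) = r * l x) ->
  (forall x, l x <= M * hnorm H x) ->
  exists v, forall x, l x = rip x v.
Proof.
intros ladd lscal lbd; set (J x := rip x x - 2 * l x).
destruct (completeness (fun r => exists x, r = - J x)) as [d [ub lub]].
- exists (M * M); intros r [x ->]; unfold J.
  specialize (lbd x); rewrite <- hnorm_sqr; pose proof (Rle_0_sqr (hnorm H x - M)).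
  unfold Rsqr in *; lra.
- exists (- J hs_zero); now exists hs_zero.
(* By the parallelogram law, |x - y|^2 is at most twice the sum of the defects of x and y. Defects
   (1/9)^m / 4 thus keep consecutive points within (1/3)^m. *)
assert (mini : forall m, exists x, - J x > d - (1 / 9) ^ m / 4).
  intros m; apply NNPP; intros h.
  assert (0 < (1 / 9) ^ m) by (apply pow_lt; lra).
  enough (d <= d - (1 / 9) ^ m / 4) by lra.
  apply lub; intros r [x ->]; apply Rnot_lt_le; intros h'; apply h; now exists x.
apply functional_choice in mini; destruct mini as [x hx].
assert (Jge : forall y, - J y <= d) by (intros y; apply ub; now exists y).
assert (pow3 : forall m, 0 < (1 / 3) ^ m) by (intros; apply pow_lt; lra).
assert (pow9 : forall m, (1 / 9) ^ m = (1 / 3) ^ m * (1 / 3) ^ m).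
  intros; rewrite <- Rpow_mult_distr; f_equal; field.
destruct (geometric_cauchy_limit x) as [v hv].
  intros m; apply hnorm_le; [apply Rlt_le, pow3|].
  pose proof (Jge (rscal (1 / 2) (hs_add (x (S m)) (x m)))) as h.
  pose proof (hx m) as h1; pose proof (hx (S m)) as h2; revert h h1 h2; unfold J.
  rewrite lscal, ladd, rip_scall, rip_scalr, !rip_subl, !rip_subr, !rip_addl, !rip_addr.
  rewrite !pow9; simpl; rewrite (rip_sym (x m) (x (S m))).
  pose proof (Rmult_lt_0_compat _ _ (pow3 m) (pow3 m)); lra.
(* Near-minimality is tested at [x m] plus or minus (1/3)^m y: the linear term of [J] must be
   dominated by the defect and the quadratic term. *)
assert (approx : forall m y, Rabs (rip (x m) y - l y) <= (1 / 3) ^ m * (1 + rip y y)).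
  intros m y; pose proof (pow3 m).
  pose proof (Jge (hs_add (x m) (rscal ((1 / 3) ^ m) y))) as h1.
  pose proof (Jge (hs_add (x m) (rscal (- (1 / 3) ^ m) y))) as h2.
  specialize (hx m); revert h1 h2 hx; unfold J.
  rewrite !ladd, !lscal, !rip_addl, !rip_addr, !rip_scall, !rip_scalr, (rip_sym y), pow9.
  pose proof (rip_ge0 y); intros h1 h2 h3.
  apply Rabs_le; split; apply Rmult_le_reg_l with (2 * (1 / 3) ^ m); nra.
exists v; intros y; rewrite rip_sym; symmetry; apply cond_eq; intros eps heps.
pose proof (rip_ge0 y); pose proof (hnorm_ge0 y).
set (C := 1 + rip y y + 3 / 2 * hnorm H y).
destruct (pow_lt_1_zero (1 / 3) ltac:(rewrite Rabs_pos_eq; lra) (eps / C)) as [N hN].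
  apply Rdiv_lt_0_compat; unfold C; lra.
specialize (hN N (le_n N)); rewrite Rabs_pos_eq in hN by (apply Rlt_le, pow3).
apply Rlt_div_r in hN; [|unfold C; lra].
apply Rle_lt_trans with (2 := hN).
replace (rip v y - l y) with (rip (hsub H v (x N)) y + (rip (x N) y - l y))
  by (rewrite rip_subl; ring).
apply Rle_trans with (1 := Rabs_triang _ _).
specialize (approx N y).
pose proof (rip_le_hnorm (hsub H v (x N)) y).
pose proof (Rmult_le_compat_r (hnorm H y) _ _ ltac:(trivial) (hv N)).
unfold C; lra.
Qed.

End RealHilbert.

(** * Complex limits and the complex inner product *)

Lemma im_le_Cmod (c : C) : Rabs (Im c) <= Cmod c.
Proof. apply Rle_trans with (2 := Rmax_Cmod c), Rmax_r. Qed.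

Lemma Cmod_le_abs (c : C) : Cmod c <= Rabs (Re c) + Rabs (Im c).
Proof.
pose proof (Rabs_pos (Re c)); pose proof (Rabs_pos (Im c)).
apply Rsqr_incr_0_var; [|lra]; unfold Rsqr.
replace (Cmod c * Cmod c) with (Cmod c ^ 2) by ring.
rewrite Cmod2_alt, <- (pow2_abs (Re c)), <- (pow2_abs (Im c)); nra.
Qed.

Lemma Cconj_RtoC (t : R) : Cconj (RtoC t) = RtoC t.
Proof. unfold Cconj, RtoC; simpl; f_equal; ring. Qed.

Lemma is_lim_seq_Re (s : nat -> C) (l : C) :
  is_lim_seq (fun n => Cmod (s n - l)%C) 0 -> is_lim_seq (fun n => Re (s n)) (Re l).
Proof.
intros h; apply is_lim_seq_ext with (fun n => Re (s n - l)%C + Re l).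
  intros n; unfold Re; simpl; ring.
replace (Finite (Re l)) with (Finite (0 + Re l)) by (f_equal; ring).
apply is_lim_seq_plus'; [|apply is_lim_seq_const].
apply is_lim_seq_abs_0, is_lim_seq_le_le with (3 := h) (1 := fun n =>
  conj (Rabs_pos _) (re_le_Cmod _)); apply is_lim_seq_const.
Qed.

Lemma is_lim_seq_Im (s : nat -> C) (l : C) :
  is_lim_seq (fun n => Cmod (s n - l)%C) 0 -> is_lim_seq (fun n => Im (s n)) (Im l).
Proof.
intros h; apply is_lim_seq_ext with (fun n => Im (s n - l)%C + Im l).
  intros n; unfold Im; simpl; ring.
replace (Finite (Im l)) with (Finite (0 + Im l)) by (f_equal; ring).
apply is_lim_seq_plus'; [|apply is_lim_seq_const].
apply is_lim_seq_abs_0, is_lim_seq_le_le with (3 := h) (1 := fun n =>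
  conj (Rabs_pos _) (im_le_Cmod _)); apply is_lim_seq_const.
Qed.

Lemma is_lim_seq_bounded (s : nat -> R) (l : R) :
  is_lim_seq s l -> exists M, forall n, Rabs (s n) <= M.
Proof.
intros h; destruct (filterlim_bounded s) as [M hM]; [now exists l|].
now exists M.
Qed.

Lemma Re_sum_n (f : nat -> C) n :
  Re (sum_n f n) = sum_f_R0 (fun j => Re (f j)) n.
Proof.
induction n as [|n IH]; [now rewrite sum_O|].
now rewrite sum_Sn, tech5, <- IH.
Qed.

Lemma Im_sum_n (f : nat -> C) n :
  Im (sum_n f n) = sum_f_R0 (fun j => Im (f j)) n.
Proof.
induction n as [|n IH]; [now rewrite sum_O|].
now rewrite sum_Sn, tech5, <- IH.
Qed.

Section ComplexHilbert.
Variable H : HilbFunSpace.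
Implicit Types u v w x y : H.

Lemma ip_addr u v w : hs_ip w (hs_add u v) = (hs_ip w u + hs_ip w v)%C.
Proof. now rewrite hs_ip_herm, hs_ip_addl, Cplus_conj, <- !hs_ip_herm. Qed.

Lemma ip_scalr a u w : hs_ip w (hs_scal a u) = (Cconj a * hs_ip w u)%C.
Proof. now rewrite hs_ip_herm, hs_ip_scall, Cmult_conj, <- hs_ip_herm. Qed.

Lemma Im_ip u v : Im (hs_ip u v) = rip H u (hs_scal Ci v).
Proof. unfold rip; rewrite ip_scalr; unfold Re, Im; simpl; ring. Qed.

Lemma hnorm_scal a u : hnorm H (hs_scal a u) = Cmod a * hnorm H u.
Proof.
unfold hnorm; rewrite <- (sqrt_Rsqr (Cmod a)) by apply Cmod_ge_0.
rewrite <- sqrt_mult_alt by apply Rle_0_sqr; f_equal.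
rewrite hs_ip_scall, ip_scalr, Cmult_assoc, <- Cmod2_conj.
replace (Rsqr (Cmod a)) with (Cmod a ^ 2) by (unfold Rsqr; ring).
generalize (Cmod a ^ 2); intros r; unfold Re, RtoC; simpl; ring.
Qed.

Lemma Cmod_ip_le u v : Cmod (hs_ip u v) <= 2 * (hnorm H u * hnorm H v).
Proof.
apply Rle_trans with (1 := Cmod_le_abs _); rewrite Im_ip.
pose proof (rip_le_hnorm H u v) as h1; pose proof (rip_le_hnorm H u (hs_scal Ci v)) as h2.
rewrite hnorm_scal, Cmod_Ci in h2; unfold rip in h1; lra.
Qed.

(** Pointwise convergence bounds the norms of [w n], so the real part of [l] is a bounded real
    functional and [riesz] applies. *)
Lemma weak_limit_representable (w : nat -> H) (l : H -> C) :
  (forall h, is_lim_seq (fun n => Cmod (hs_ip h (w n) - l h)%C) 0) ->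
  exists v, forall h, l h = hs_ip h v.
Proof.
intros hl.
assert (hre : forall h, is_lim_seq (fun n => rip H h (w n)) (Re (l h)))
  by (intros h; apply is_lim_seq_Re with (1 := hl h)).
assert (uniq : forall s (a b : R), is_lim_seq s a -> is_lim_seq s b -> a = b).
  intros s a b ha hb; apply is_lim_seq_unique in ha; apply is_lim_seq_unique in hb.
  rewrite ha in hb; now injection hb.
destruct (uniform_boundedness H (fun x => exists n, x = w n)) as [M [hM hMw]].
  intros x; destruct (is_lim_seq_bounded _ _ (hre x)) as [M hM].
  exists M; intros y [n ->]; apply hM.
destruct (riesz H (fun h => Re (l h)) M) as [v hv].
- intros x y; apply uniq with (1 := hre _).
  apply is_lim_seq_ext with (fun n => rip H x (w n) + rip H y (w n)).
    intros n; symmetry; apply rip_addl.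
  now apply is_lim_seq_plus'.
- intros r x; apply uniq with (1 := hre _).
  apply is_lim_seq_ext with (fun n => r * rip H x (w n)).
    intros n; symmetry; apply rip_scall.
  apply is_lim_seq_mult'; [apply is_lim_seq_const|apply hre].
- intros x; refine (is_lim_seq_le _ _ (Finite _) (Finite _) _ (hre x) (is_lim_seq_const _)).
  intros n; apply Rle_trans with (1 := Rle_abs _).
  apply Rle_trans with (1 := rip_le_hnorm _ _ _).
  rewrite Rmult_comm; apply Rmult_le_compat_r; [apply hnorm_ge0|].
  now apply hMw; exists n.
exists v; intros h.
(* The limit inherits l(i h) = i l(h), so its real part determines its imaginary part. *)
assert (him : Im (l h) = - Re (l (hs_scal Ci h))).
  apply uniq with (1 := is_lim_seq_Im _ _ (hl h)).
  apply is_lim_seq_ext with (fun n => - rip H (hs_scal Ci h) (w n)).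
    intros n; unfold rip; rewrite hs_ip_scall; unfold Re, Im; simpl; ring.
  apply is_lim_seq_opp with (1 := hre _).
rewrite hv in him; pose proof (hv h) as hr; revert hr him; unfold rip.
rewrite hs_ip_scall; unfold Re, Im; destruct (l h) as [a b], (hs_ip h v) as [c d]; simpl.
intros -> ->; f_equal; ring.
Qed.

Lemma norm_conv_weak_conv (s : nat -> H) h : norm_conv H s h -> weak_conv H s h.
Proof.
intros hs g.
apply is_lim_seq_le_le with (fun _ => 0) (fun n => 2 * hnorm H g * hnorm H (hsub H (s n) h)).
- intros n; split; [apply Cmod_ge_0|].
  replace (hs_ip (s n) g - hs_ip h g)%C with (hs_ip (hsub H (s n) h) g).
    apply Rle_trans with (1 := Cmod_ip_le _ _); right; ring.
  unfold hsub; rewrite hs_ip_addl, hs_ip_scall; ring.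
- apply is_lim_seq_const.
- replace (Finite 0) with (Finite (2 * hnorm H g * 0)) by (f_equal; ring).
  apply is_lim_seq_mult'; [apply is_lim_seq_const|exact hs].
Qed.

Fixpoint vsum (e : nat -> H) (n : nat) : H :=
  match n with
  | O => e O
  | S m => hs_add (vsum e m) (e (S m))
  end.

Lemma rip_vsum (e : nat -> H) n g :
  rip H (vsum e n) g = sum_f_R0 (fun j => rip H (e j) g) n.
Proof. induction n as [|n IH]; simpl; [trivial|now rewrite rip_addl, IH]. Qed.

Lemma ev_vsum (e : nat -> H) n z : Disk z ->
  hs_ev (vsum e n) z = sum_n (fun j => hs_ev (e j) z) n.
Proof.
intros hz; induction n as [|n IH]; simpl; [now rewrite sum_O|].
now rewrite sum_Sn, hs_ev_add, IH by trivial.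
Qed.

End ComplexHilbert.

(** * Taylor coefficients *)

Lemma polyfun_monomial j z :
  polyfun (fun i => if Nat.eqb i j then RtoC 1 else RtoC 0) j z = Cpow z j.
Proof.
assert (small : forall n, (n < j)%nat ->
  polyfun (fun i => if Nat.eqb i j then RtoC 1 else RtoC 0) n z = RtoC 0).
  unfold polyfun; induction n as [|n IH]; intros hn.
    rewrite sum_O; destruct (Nat.eqb_spec 0 j); [lia|ring].
  rewrite sum_Sn, IH by lia; destruct (Nat.eqb_spec (S n) j); [lia|].
  change plus with Cplus; ring.
unfold polyfun in *; destruct j as [|j].
  rewrite sum_O; simpl; ring.
rewrite sum_Sn, small, Nat.eqb_refl by lia; change plus with Cplus; ring.
Qed.

Lemma Disk_real x : 0 <= x < 1 -> Disk (RtoC x).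
Proof. intros hx; unfold Disk; rewrite Cmod_R, Rabs_pos_eq; lra. Qed.

(** [C_derive] takes its limits along the horizontal line through z, and the points of that line
    near z lie in the disk. *)
Lemma C_derive_ext_Disk (f g : C -> C) z :
  (forall w, Disk w -> f w = g w) -> Disk z -> C_derive f z = C_derive g z.
Proof.
intros hfg hz.
assert (line : forall t, Rabs (t - fst z) < 1 - Cmod z -> Disk (t, snd z)).
  intros t ht; unfold Disk.
  replace (t, snd z) with (z + RtoC (t - fst z))%C
    by (destruct z; unfold Cplus, RtoC; simpl; f_equal; ring).
  apply Rle_lt_trans with (1 := Cmod_triangle _ _); rewrite Cmod_R; lra.
assert (hr : 0 < 1 - Cmod z) by (unfold Disk in hz; lra).
unfold C_derive, C_lim; f_equal; f_equal; apply Lim_ext_loc.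
all: exists (mkposreal _ hr); intros t ht _.
all: now rewrite !hfg by (trivial; apply line, ht).
Qed.

Lemma C_derive_n_ext_Disk j (f g : C -> C) z :
  (forall w, Disk w -> f w = g w) -> Disk z -> C_derive_n j f z = C_derive_n j g z.
Proof.
intros hfg; revert z; induction j as [|j IH]; intros z hz; [now apply hfg|].
now apply C_derive_ext_Disk.
Qed.

(** The inner conjugations cancel in pairs. This will turn [k0j] into the conjugate of a Taylor
    coefficient. *)
Lemma dbar_n_conj j (g : C -> C) w :
  dbar_n j g w = Cconj (C_derive_n j (fun u => Cconj (g u)) w).
Proof.
revert w; induction j as [|j IH]; intros w; simpl; [now rewrite Cconj_conj|].
change (Cconj (C_derive (fun u => Cconj (dbar_n j g u)) w)
  = Cconj (C_derive (C_derive_n j (fun u => Cconj (g u))) w)).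
f_equal; unfold C_derive, C_lim; f_equal; f_equal; apply Lim_ext.
all: now intros x; rewrite !IH, !Cconj_conj.
Qed.

Lemma sum_geometric_tail (f : nat -> R) (c q : R) n p :
  0 <= c -> 0 <= q <= 1 / 2 -> (forall j, Rabs (f j) <= c * q ^ j) ->
  Rabs (sum_f_R0 f (n + p) - sum_f_R0 f n) <= 2 * c * q ^ S n.
Proof.
intros hc hq hf.
assert (hp : forall i, 0 <= c * q ^ i)
  by (intros; apply Rmult_le_pos; [trivial|apply pow_le; lra]).
(* The subtracted term strengthens the bound so that the induction on p closes; q <= 1 / 2 absorbs
   each new term. *)
apply Rle_trans with (2 * (c * q ^ S n - c * q ^ S (n + p))); [|pose proof (hp (S (n + p))); lra].
induction p as [|p IH].
  rewrite Nat.add_0_r, Rminus_diag, Rabs_R0; lra.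
rewrite Nat.add_succ_r, tech5.
replace (_ + _ - _) with (sum_f_R0 f (n + p) - sum_f_R0 f n + f (S (n + p))) by ring.
apply Rle_trans with (1 := Rabs_triang _ _).
specialize (hf (S (n + p))); specialize (hp (S (n + p))).
replace (c * q ^ S (S (n + p))) with (q * (c * q ^ S (n + p))) by (simpl; ring).
nra.
Qed.

(** For fixed n the weights tend to 1, so the head of the mean tends to the ordinary partial sum.
    The weights lie in [0, 1], so the rest is dominated by a geometric tail uniformly in m. *)
Lemma cesaro_limit_remainder alpha (b : nat -> R) (l c q : R) n :
  0 <= alpha -> 0 <= c -> 0 <= q <= 1 / 2 -> (forall j, Rabs (b j) <= c * q ^ j) ->
  is_lim_seq (fun m => sum_f_R0 (fun j =>
    gbinom (INR m) j / gbinom (INR m + alpha) j * b j) m) l ->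
  Rabs (l - sum_f_R0 b n) <= 2 * c * q ^ S n.
Proof.
intros ha hc hq hb hl.
set (r m j := gbinom (INR m) j / gbinom (INR m + alpha) j) in *.
assert (head : is_lim_seq (fun m => sum_f_R0 (fun j => r m j * b j) n) (sum_f_R0 b n)).
  assert (term : forall j, is_lim_seq (fun m => r m j * b j) (b j)).
    intros j; replace (Finite (b j)) with (Finite (1 * b j)) by (f_equal; ring).
    apply is_lim_seq_mult'; [now apply gbinom_ratio_lim|apply is_lim_seq_const].
  induction n as [|n IH]; [apply term|].
  now apply is_lim_seq_plus'.
refine (is_lim_seq_le_loc _ _ (Finite _) (Finite _) _
  (is_lim_seq_abs _ _ (is_lim_seq_minus' _ _ _ _ hl head)) (is_lim_seq_const _)).
exists n; intros m hm.
change (Rabs (sum_f_R0 (fun j => r m j * b j) m - sum_f_R0 (fun j => r m j * b j) n)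
  <= 2 * c * q ^ S n).
(* Terms with j > m are set to 0, since the tail estimate asks for a bound at every j and the
   weights are controlled only for j <= m. *)
rewrite (sum_eq (fun j => r m j * b j)
  (fun j => if Nat.leb j m then r m j * b j else 0) m)
  by (intros j hj; now rewrite (proj2 (Nat.leb_le _ _) hj)).
rewrite (sum_eq (fun j => r m j * b j)
  (fun j => if Nat.leb j m then r m j * b j else 0) n)
  by (intros j hj; rewrite (proj2 (Nat.leb_le j m)); [trivial|lia]).
pose proof (sum_geometric_tail (fun j => if Nat.leb j m then r m j * b j else 0)
  c q n (m - n) hc hq) as tail.
replace (n + (m - n))%nat with m in tail by lia.
apply tail; intros j.
pose proof (hb j); pose proof (Rabs_pos (b j)).
destruct (Nat.leb_spec j m) as [hj|_]; [|rewrite Rabs_R0; lra].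
destruct (gbinom_ratio_bounds alpha m j ha hj) as [h0 h1].
rewrite Rabs_mult, (Rabs_pos_eq (r m j)) by exact h0.
unfold r; nra.
Qed.

(** * Taylor coefficients as bounded functionals *)

Section CesaroKernel.
Variable H : HilbFunSpace.
Variable k : C -> H.
Hypothesis Hk : forall w, Disk w -> forall h : H, hs_ev h w = hs_ip h (k w).
Variable alpha : R.
Hypothesis Halpha : 0 <= alpha.
Variable u : nat -> H.
Hypothesis Hu : forall j z, Disk z -> hs_ev (u j) z = Cpow z j.
Hypothesis Hconv : forall (h : H) (s : nat -> H),
  (forall n z, Disk z -> hs_ev (s n) z = sigma_fun alpha n (hs_ev h) z) ->
  weak_conv H s h.

Let coef (h : H) (j : nat) : C := taylor_coef (hs_ev h) j.
Let A (j : nat) : R := negbin (1 + alpha) j.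

Lemma A_pos j : 0 < A j.
Proof. apply negbin_pos; lra. Qed.

Lemma cesaro_means_rip_lim h g :
  is_lim_seq (fun n => sum_f_R0 (fun j =>
    gbinom (INR n) j / gbinom (INR n + alpha) j
    * rip H (hs_scal (coef h j) (u j)) g) n) (rip H h g).
Proof.
set (s n := vsum H (fun j => rscal H (gbinom (INR n) j / gbinom (INR n + alpha) j)
  (hs_scal (coef h j) (u j))) n).
apply is_lim_seq_ext with (fun n => rip H (s n) g).
  intros n; unfold s; rewrite rip_vsum; apply sum_eq; intros; apply rip_scall.
apply is_lim_seq_Re, Hconv; intros n z hz.
unfold s; rewrite ev_vsum by exact hz; apply sum_n_ext; intros j.
unfold rscal; rewrite !hs_ev_scal, Hu by exact hz; apply Cmult_assoc.
Qed.

(** For each g, [cesaro_term_bound] bounds the terms by a multiple of A_j depending on g; uniform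
    boundedness of the vectors a_j(h) z^j / A_j removes that dependence. *)
Lemma coef_hnorm_bound h :
  exists M, 0 <= M /\ forall j, Cmod (coef h j) * hnorm H (u j) <= M * A j.
Proof.
destruct (cesaro_term_bound alpha Halpha) as [K [hK cesaro]].
destruct (uniform_boundedness H (fun w => exists j,
  w = rscal H (/ A j) (hs_scal (coef h j) (u j)))) as [M [hM bound]].
  intros g; destruct (is_lim_seq_bounded _ _ (cesaro_means_rip_lim h g)) as [S hS].
  exists (K * S); intros w [j ->].
  rewrite rip_scalr, Rabs_mult, rip_sym, Rmult_comm.
  pose proof (A_pos j) as hA; rewrite (Rabs_pos_eq (/ A j)) by (apply Rlt_le, Rinv_0_lt_compat, hA).
  apply Rle_div_l; [exact hA|].
  exact (cesaro (fun j => rip H (hs_scal (coef h j) (u j)) g) S hS j).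
exists M; split; [exact hM|]; intros j; pose proof (A_pos j) as hA.
specialize (bound _ (ex_intro _ j eq_refl)).
rewrite hnorm_rscal, hnorm_scal in bound.
rewrite Rabs_pos_eq, Rmult_comm in bound by (apply Rlt_le, Rinv_0_lt_compat, hA).
now apply Rle_div_l in bound.
Qed.

(** Evaluating a_j(h) z^j at 1/2 gives |a_j(h)| 2^(-j) <= 2 |k_(1/2)| M A_j, and A_j <= (1 +
    alpha)^j. *)
Lemma coef_geometric_bound h :
  exists c, 0 <= c /\ forall j, Cmod (coef h j) <= c * (2 * (1 + alpha)) ^ j.
Proof.
destruct (coef_hnorm_bound h) as [M [hM hj]].
set (g := k (RtoC (1 / 2))); pose proof (hnorm_ge0 H g).
exists (2 * hnorm H g * M); split; [apply Rmult_le_pos; lra|]; intros j.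
assert (e : Cmod (hs_ip (hs_scal (coef h j) (u j)) g) = Cmod (coef h j) * (1 / 2) ^ j).
  assert (Disk (RtoC (1 / 2))) by (apply Disk_real; lra).
  unfold g; rewrite <- Hk, hs_ev_scal, Hu, Cmod_mult, Cmod_pow, Cmod_R by trivial.
  rewrite (Rabs_pos_eq (1 / 2)); lra.
pose proof (Cmod_ip_le H (hs_scal (coef h j) (u j)) g) as cs; rewrite e, hnorm_scal in cs.
pose proof (negbin_le_pow (1 + alpha) j ltac:(lra)) as hA; fold (A j) in hA.
assert (h2 : 0 < 2 ^ j) by (apply pow_lt; lra).
replace (Cmod (coef h j)) with (2 ^ j * (Cmod (coef h j) * (1 / 2) ^ j)).
  rewrite Rpow_mult_distr.
  replace (2 * hnorm H g * M * (2 ^ j * (1 + alpha) ^ j))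
    with (2 ^ j * (2 * (M * (1 + alpha) ^ j * hnorm H g))) by ring.
  apply Rmult_le_compat_l; [lra|]; apply Rle_trans with (1 := cs).
  apply Rmult_le_compat_l; [lra|]; apply Rmult_le_compat_r; [trivial|].
  apply Rle_trans with (1 := hj j); now apply Rmult_le_compat_l.
rewrite Rmult_comm, Rmult_assoc, <- Rpow_mult_distr.
replace (1 / 2 * 2) with 1 by field; rewrite pow1; ring.
Qed.

Lemma taylor_remainder h n :
  exists c r, 0 < r /\ forall x, 0 <= x < r ->
  Cmod (hs_ev h (RtoC x) - sum_n (fun j => coef h j * RtoC x ^ j)%C n)%C <= c * x ^ S n.
Proof.
destruct (coef_geometric_bound h) as [c [hc bound]].
set (rho := 2 * (1 + alpha)) in *; assert (hrho : 2 <= rho) by (unfold rho; lra).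
(* The radius makes the ratio [rho * x] at most 1 / 2. The factor 4 adds a bound with factor 2 for
   the real part to one for the imaginary part. *)
exists (4 * c * rho ^ S n), (/ (2 * rho)); split; [apply Rinv_0_lt_compat; lra|].
intros x [hx0 hxr].
assert (hq : 0 <= rho * x <= 1 / 2).
  split; [apply Rmult_le_pos; lra|].
  apply (Rmult_lt_compat_l rho) in hxr; [|lra].
  replace (rho * / (2 * rho)) with (1 / 2) in hxr by (field; lra); lra.
assert (hx : Disk (RtoC x)) by (apply Disk_real; nra).
assert (term : forall j, hs_ip (hs_scal (coef h j) (u j)) (k (RtoC x))
  = (coef h j * RtoC x ^ j)%C).
  intros j; now rewrite <- Hk, hs_ev_scal, Hu by exact hx.
assert (size : forall j, Cmod (coef h j * RtoC x ^ j)%C <= c * (rho * x) ^ j).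
  intros j; rewrite Cmod_mult, Cmod_pow, Cmod_R, (Rabs_pos_eq x), Rpow_mult_distr by trivial.
  rewrite <- Rmult_assoc; apply Rmult_le_compat_r; [now apply pow_le|apply bound].
(* Used with g = k_x for the real part and g = i k_x for the imaginary part. *)
assert (part : forall g, (forall j, Rabs (rip H (hs_scal (coef h j) (u j)) g)
      <= Cmod (coef h j * RtoC x ^ j)%C) ->
    Rabs (rip H h g - sum_f_R0 (fun j => rip H (hs_scal (coef h j) (u j)) g) n)
    <= 2 * c * (rho * x) ^ S n).
  intros g hg.
  apply (cesaro_limit_remainder alpha); trivial; [|apply cesaro_means_rip_lim].
  intros j; apply Rle_trans with (1 := hg j), size.
apply Rle_trans with (1 := Cmod_le_abs _).
rewrite Hk by exact hx.
assert (hre : Rabs (Re (hs_ip h (k (RtoC x))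
    - sum_n (fun j => coef h j * RtoC x ^ j)%C n)%C) <= 2 * c * (rho * x) ^ S n).
  replace (Re _) with (rip H h (k (RtoC x))
      - sum_f_R0 (fun j => rip H (hs_scal (coef h j) (u j)) (k (RtoC x))) n).
    apply part; intros j; unfold rip; rewrite term; apply re_le_Cmod.
  unfold Cminus; change (Re (?a + - ?b)%C) with (Re a - Re b).
  rewrite Re_sum_n; f_equal; apply sum_eq; intros j _; unfold rip; now rewrite term.
assert (him : Rabs (Im (hs_ip h (k (RtoC x))
    - sum_n (fun j => coef h j * RtoC x ^ j)%C n)%C) <= 2 * c * (rho * x) ^ S n).
  replace (Im _) with (rip H h (hs_scal Ci (k (RtoC x)))
      - sum_f_R0 (fun j => rip H (hs_scal (coef h j) (u j)) (hs_scal Ci (k (RtoC x)))) n).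
    apply part; intros j; rewrite <- Im_ip, term; apply im_le_Cmod.
  unfold Cminus; change (Im (?a + - ?b)%C) with (Im a - Im b).
  rewrite Im_sum_n, <- Im_ip; f_equal; apply sum_eq; intros j _.
  now rewrite <- Im_ip, term.
rewrite Rpow_mult_distr in hre, him; lra.
Qed.

(* By induction on n: a_n(h) is the limit of (h(x) - sum_(j < n) a_j(h) x^j) / x^n
   as x -> 0, so it is a pointwise limit of evaluations at vectors of H. *)
Lemma coef_representable n : exists v, forall h, coef h n = hs_ip h v.
Proof.
(* Here [p x] represents the Taylor remainder of order m at x. Divided by x^(m+1), it differs from
   a_(m+1)(h) by at most c x, by [taylor_remainder] at order m + 1. *)
assert (step : forall m (p : R -> H),
    (forall h x, 0 < x < 1 ->
       hs_ip h (p x) = (hs_ev h (RtoC x) - sum_n (fun j => coef h j * RtoC x ^ j)%C m)%C) ->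
    exists v, forall h, coef h (S m) = hs_ip h v).
  intros m p hp; set (x i := / (INR i + 2)).
  assert (hx : forall i, 0 < x i < 1).
    intros i; pose proof (pos_INR i); unfold x; split; [apply Rinv_0_lt_compat; lra|].
    rewrite <- Rinv_1; apply Rinv_lt_contravar; lra.
  assert (xlim : is_lim_seq x 0).
    assert (h : is_lim_seq (fun i => INR i + 2) p_infty).
      eapply is_lim_seq_plus; [apply is_lim_seq_INR|apply is_lim_seq_const|reflexivity].
    apply (is_lim_seq_inv _ _ h); discriminate.
  apply weak_limit_representable with (w := fun i => rscal H (/ x i ^ S m) (p (x i))).
  intros h; destruct (taylor_remainder h (S m)) as [c [r [hr bound]]].
  apply is_lim_seq_le_le_loc with (fun _ => 0) (fun i => c * x i).
  - pose proof xlim as near; apply is_lim_seq_spec in near.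
    destruct (near (mkposreal r hr)) as [N hN]; exists N; intros i hi.
    specialize (hN i hi); simpl in hN; destruct (hx i) as [h0 h1].
    rewrite Rminus_0_r, Rabs_pos_eq in hN by lra.
    split; [apply Cmod_ge_0|].
    specialize (bound (x i) (conj (Rlt_le _ _ h0) hN)).
    rewrite sum_Sn in bound.
    unfold rscal; rewrite ip_scalr, hp by exact (hx i).
    assert (hpow : 0 < x i ^ S m) by (apply pow_lt; lra).
    assert (nz : RtoC (x i ^ S m) <> RtoC 0) by (intros e; apply RtoC_inj in e; lra).
    rewrite Cconj_RtoC, RtoC_inv by lra.
    set (t := sum_n _ m) in *; change plus with Cplus in bound.
    rewrite <- RtoC_pow in bound.
    replace (/ RtoC (x i ^ S m) * (hs_ev h (RtoC (x i)) - t) - coef h (S m))%C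
      with ((hs_ev h (RtoC (x i)) - (t + coef h (S m) * RtoC (x i ^ S m)))
        / RtoC (x i ^ S m))%C by (field; exact nz).
    rewrite Cmod_div, Cmod_R, (Rabs_pos_eq (x i ^ S m)) by (trivial; lra).
    apply Rle_div_l; [exact hpow|].
    apply Rle_trans with (1 := bound); right; simpl; ring.
  - apply is_lim_seq_const.
  - replace (Finite 0) with (Finite (c * 0)) by (f_equal; ring).
    apply is_lim_seq_mult'; [apply is_lim_seq_const|exact xlim].
assert (h0 : forall h, coef h 0 = hs_ip h (k (RtoC 0))).
  intros h; rewrite <- Hk by (apply Disk_real; lra).
  unfold coef, taylor_coef; simpl; field; intros e; injection e; lra.
(* The induction also carries the remainder vectors [p], which the next use of [step] consumes. *)
assert (all : forall m, (exists v, forall h, coef h m = hs_ip h v) /\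
    exists p : R -> H, forall h x, 0 < x < 1 ->
      hs_ip h (p x) = (hs_ev h (RtoC x) - sum_n (fun j => coef h j * RtoC x ^ j)%C m)%C).
  induction m as [|m [_ [p hp]]].
    split; [now exists (k (RtoC 0))|].
    exists (fun x => hs_add (k (RtoC x)) (hs_scal (RtoC (-1)) (k (RtoC 0)))).
    intros h x hx; rewrite ip_addr, ip_scalr, Cconj_RtoC, <- h0, <- Hk, sum_O
      by (apply Disk_real; lra).
    simpl; ring.
  destruct (step m p hp) as [v hv]; split; [now exists v|].
  exists (fun x => hs_add (p x) (hs_scal (RtoC (- x ^ S m)) v)).
  intros h x hx; rewrite ip_addr, ip_scalr, Cconj_RtoC, <- hv, hp, sum_Sn by exact hx.
  change plus with Cplus; rewrite RtoC_opp, RtoC_pow; ring.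
apply all.
Qed.

End CesaroKernel.

(** * Growth of the norms of the monomials and the kernel derivatives *)

Theorem theorem6p7
  (H : HilbFunSpace)
  (* norm convergence in H implies pointwise convergence on the disk *)
  (Hpw : forall (s : nat -> H) (h : H), norm_conv H s h ->
           forall z, Disk z -> is_lim_seq (fun n => Cmod (hs_ev (s n) z - hs_ev h z)%C) 0)
  (* H contains the polynomials *)
  (Hpoly : forall (a : nat -> C) (n : nat),
           exists v : H, forall z, Disk z -> hs_ev v z = polyfun a n z)
  (* k : the reproducing kernel, k_w in H with h(w) = <h, k_w> *)
  (k : C -> H)
  (Hk : forall w, Disk w -> forall h : H, hs_ev h w = hs_ip h (k w))
  (alpha : R) (Halpha : 0 <= alpha)
  (* sigma_n^alpha(h) -> h in norm for all h, or weakly for all h *)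
  (Hconv : (forall (h : H) (s : nat -> H),
              (forall n z, Disk z -> hs_ev (s n) z = sigma_fun alpha n (hs_ev h) z) ->
              norm_conv H s h)
        \/ (forall (h : H) (s : nat -> H),
              (forall n z, Disk z -> hs_ev (s n) z = sigma_fun alpha n (hs_ev h) z) ->
              weak_conv H s h)) :
  exists (M : R) (N : nat), forall j : nat, (N <= j)%nat ->
    exists u v : H,
      (forall z, Disk z -> hs_ev u z = Cpow z j) /\
      (forall z, Disk z -> hs_ev v z = k0j k j z) /\
      hnorm H u * hnorm H v <= M * Rpower (INR j) alpha.
Proof.
assert (Hweak : forall (h : H) (s : nat -> H),
    (forall n z, Disk z -> hs_ev (s n) z = sigma_fun alpha n (hs_ev h) z) ->
    weak_conv H s h).
  destruct Hconv as [hc|hc]; [|exact hc].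
  intros h s hs; apply norm_conv_weak_conv, hc, hs.
destruct (functional_choice (fun j (v : H) => forall z, Disk z -> hs_ev v z = Cpow z j)) as [u hu].
  intros j; destruct (Hpoly (fun i => if Nat.eqb i j then RtoC 1 else RtoC 0) j) as [v hv].
  exists v; intros z hz; rewrite hv by exact hz; apply polyfun_monomial.
destruct (functional_choice _ (coef_representable H k Hk alpha Halpha u hu Hweak)) as [v hv].
(* Pairing h with these vectors gives |z^j| a_j(h) / A_j up to conjugation, which [coef_hnorm_bound]
   bounds for each h. *)
destruct (uniform_boundedness H (fun w => exists j,
  w = rscal H (hnorm H (u j) / negbin (1 + alpha) j) (v j))) as [M [hM bound]].
  intros h; destruct (coef_hnorm_bound H alpha Halpha u hu Hweak h) as [M [hM hj]].
  exists M; intros w [j ->].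
  pose proof (negbin_pos (1 + alpha) j ltac:(lra)) as hA.
  rewrite rip_scalr; unfold rip; rewrite <- hv.
  pose proof (hnorm_ge0 H (u j)).
  rewrite Rabs_mult, Rabs_pos_eq by (apply Rle_div_r; lra).
  replace (hnorm H (u j) / negbin (1 + alpha) j * _)
    with (Rabs (Re (taylor_coef (hs_ev h) j)) * hnorm H (u j) / negbin (1 + alpha) j)
    by (field; lra).
  apply Rle_div_l; [exact hA|]; apply Rle_trans with (2 := hj j).
  apply Rmult_le_compat_r; [trivial|apply re_le_Cmod].
(* The factor 1 + alpha comes from [negbin_le_Rpower], which starts at index 1. *)
exists (M * (1 + alpha)), 1%nat; intros [|j] hj; [lia|].
exists (u (S j)), (v (S j)); split; [apply hu|split].
  intros z hz; unfold k0j; rewrite dbar_n_conj.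
  (* The conjugate of k_w(z) is k_z(w), by Hermitian symmetry, for w in the disk; this suffices for
     derivatives at 0. *)
  rewrite (C_derive_n_ext_Disk _ _ (hs_ev (k z))); [| |apply Disk_real; lra].
    rewrite Hk, hs_ip_herm, <- hv by exact hz; unfold taylor_coef, Cdiv.
    rewrite Cmult_conj, Cmult_comm; f_equal.
    now rewrite <- RtoC_inv, Cconj_RtoC by apply INR_fact_neq_0.
  intros w hw; rewrite !Hk by trivial; symmetry; apply hs_ip_herm.
specialize (bound _ (ex_intro _ (S j) eq_refl)).
pose proof (negbin_pos (1 + alpha) (S j) ltac:(lra)) as hA.
pose proof (hnorm_ge0 H (u (S j))).
rewrite hnorm_rscal, Rabs_pos_eq in bound by (apply Rle_div_r; lra).
replace (hnorm H (u (S j)) / negbin (1 + alpha) (S j) * hnorm H (v (S j)))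
  with (hnorm H (u (S j)) * hnorm H (v (S j)) / negbin (1 + alpha) (S j)) in bound
  by (field; lra).
apply Rle_div_l in bound; [|exact hA].
apply Rle_trans with (1 := bound); rewrite Rmult_assoc.
apply Rmult_le_compat_l; [exact hM|now apply negbin_le_Rpower].
Qed.
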